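(* Let $A>0$ and define $\ell:[0,\infty)\to\mathbb R$ by $$\ell(\nu)=\limsup_{n\to\infty}\frac1n\log\mathrm{Vol}\left([-A,A]^n\oplus B_n(\sqrt{n\nu})\right).$$ Then $\ell$ is continuous on $[0,\infty)$. For $\nu>0$, $$\ell(\nu)=H(\theta^* )+(1-\theta^* )\log 2A+\frac{\theta^*}{2}\log\frac{2\pi e\nu}{\theta^*},$$ where $H$ is the binary entropy function and $\theta^*\in(0,1)$ is the unique solution to $$\frac{(1-\theta^* )^2}{{\theta^*}^3}=\frac{2A^2}{\pi\nu}.$$
   Context: Logarithms are natural. $B_n(r)$ is the closed Euclidean ball of radius $r$ in $\mathbb R^n$ centered at the origin, $\oplus$ denotes Minkowski sum, and $\mathrm{Vol}$ is $n$-dimensional Lebesgue measure. $H(\theta)=-\theta\log\theta-(1-\theta)\log(1-\theta)$. *)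

(* Defs.v *)
From HB Require Import structures.
From mathcomp Require Import all_boot all_order all_algebra.
From mathcomp Require Import all_classical all_reals all_analysis.

Set Implicit Arguments.
Unset Strict Implicit.
Unset Printing Implicit Defensive.

Import Order.TTheory GRing.Theory Num.Theory.
Import numFieldNormedType.Exports.

Local Open Scope classical_set_scope.
Local Open Scope ring_scope.

Definition cons_pair (T : Type) (n : nat) (p : T * n.-tuple T) : n.+1.-tuple T :=
  [tuple of p.1 :: p.2].

(* The n-fold product of [lebesgue_measure], on the product (= Borel)
   sigma-algebra of n-tuples. [lebesgue_tuple_sigma_finite] and
   [lebesgue_tuple_box] below characterize it. *)
Fixpoint lebesgue_tuple (R : realType) (n : nat) :
    set (n.-tuple (measurableTypeR R)) -> \bar R :=
  match n with
  | 0 => dirac ([tuple] : 0.-tuple (measurableTypeR R))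
  | m.+1 => pushforward (lebesgue_measure \x @lebesgue_tuple R m)%E
              (@cons_pair (measurableTypeR R) m)
  end.

(* 'rV[R]_n carries no sigma-algebra in the library, hence the detour through
   tuples; the norm of 'rV[R]_n there is the sup norm, hence [norm2]. *)
Definition Vol (R : realType) (n : nat) (S : set 'rV[R]_n) : \bar R :=
  lebesgue_tuple
    [set t : n.-tuple (measurableTypeR R) | S (\row_(i < n) tnth t i)].

Definition norm2 (R : realType) (n : nat) (x : 'rV[R]_n) : R :=
  Num.sqrt (\sum_(i < n) x ord0 i ^+ 2).

Definition eball (R : realType) (n : nat) (r : R) : set 'rV[R]_n :=
  [set x | norm2 x <= r].
Arguments eball {R} n r _.

Definition cube (R : realType) (n : nat) (A : R) : set 'rV[R]_n :=
  [set x | forall i : 'I_n, - A <= x ord0 i <= A].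
Arguments cube {R} n A _.

Definition minkowski_sum (V : zmodType) (S T : set V) : set V :=
  [set x + y | x in S & y in T].

Definition ell (R : realType) (A nu : R) : \bar R :=
  limn_esup (fun n : nat =>
    (n%:R^-1)%:E *
      lne (Vol (minkowski_sum (cube n A) (eball n (Num.sqrt (n%:R * nu))))))%E.

Definition binary_entropy (R : realType) (t : R) : R :=
  - t * ln t - (1 - t) * ln (1 - t).

Section lebesgue_tuple_theory.
Variable R : realType.
Local Notation T := (measurableTypeR R).

Lemma measurable_cons_pair (n : nat) : measurable_fun setT (@cons_pair T n).
Proof. exact: measurable_cons. Qed.

Lemma preimage_cons_pair (n : nat) (A : 'I_n.+1 -> set T) :
  @cons_pair T n @^-1` [set t | forall i, A i (tnth t i)] =
  A ord0 `*` [set t | forall i, A (lift ord0 i) (tnth t i)].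
Proof.
apply/seteqP; split => -[a t] /=.
  move=> h; split; first exact: (h ord0).
  by move=> i; have := h (lift ord0 i); rewrite tnthS.
move=> [Aa At] i; case: (unliftP ord0 i) => [j ->|->//].
by rewrite tnthS; exact: At.
Qed.

Lemma measurable_tuple_box (n : nat) (A : 'I_n -> set T) :
  (forall i, measurable (A i)) ->
  measurable [set t : n.-tuple T | forall i, A i (tnth t i)].
Proof.
move=> mA; rewrite (_ : [set _ | _] =
    \bigcap_(i in [set: 'I_n]) ((fun t : n.-tuple T => tnth t i) @^-1` A i)).
  apply: fin_bigcap_measurable => // i _; rewrite -[X in measurable X]setTI.
  exact: measurable_tnth.
by apply/seteqP; split=> t /= h i => [_|]; exact: h.
Qed.

Lemma lebesgue_tuple_sigma_finite (n : nat) :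
  exists m : {sigma_finite_measure set (n.-tuple T) -> \bar R},
    @lebesgue_tuple R n = m.
Proof.
elim: n => [|n [m mE]].
  by exists (@dirac _ _ ([tuple] : 0.-tuple T) R).
pose leb : {sigma_finite_measure set T -> \bar R} := lebesgue_measure.
pose nu : {measure set (T * n.-tuple T)%type -> \bar R} := (leb \x m)%E.
have sf : sigma_finite setT (pushforward nu (@cons_pair T n)).
  have /sigma_finiteP[F [TF ndF mF]] := sigma_finiteT leb.
  have /sigma_finiteP[G [TG ndG mG]] := sigma_finiteT m.
  pose g (t : n.+1.-tuple T) := (thead t, [tuple of behead t] : n.-tuple T).
  exists (fun k => g @^-1` (F k `*` G k)).
    apply/seteqP; split => // t _.
    have [i _ Fi] : (\bigcup_i F i) (g t).1 by rewrite -TF.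
    have [j _ Gj] : (\bigcup_i G i) (g t).2 by rewrite -TG.
    exists (maxn i j) => //; split.
      by move: Fi; exact/subsetPset/ndF/leq_maxl.
    by move: Gj; exact/subsetPset/ndG/leq_maxr.
  move=> k; have [mFk Fk] := mF k; have [mGk Gk] := mG k; split.
    rewrite -[X in measurable X]setTI.
    have mg : measurable_fun setT g.
      apply: measurable_fun_pair; first exact: measurable_tnth.
      exact: measurable_behead.
    by apply: mg => //; exact: measurableX.
  rewrite /pushforward -comp_preimage (_ : g \o _ = id); last first.
    by apply/funext => -[a t]; congr pair; apply: val_inj.
  by rewrite preimage_id /= product_measure1E// lte_mul_pinfty// ge0_fin_numE.
pose m0 := HB.pack_for {measure set (n.+1.-tuple T) -> \bar R}
  (pushforward nu (@cons_pair T n)).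
pose m1 : {measure set (n.+1.-tuple T) -> \bar R} :=
  m0 (@measurable_cons_pair n).
pose H2 := Measure_isSigmaFinite.Build _ _ _ (Measure.sort m1) sf.
pose m2 := HB.pack_for {sigma_finite_measure set (n.+1.-tuple T) -> \bar R}
  (Measure.sort m1) H2.
by exists m2; rewrite /= mE.
Qed.

Lemma lebesgue_tuple_box (n : nat) (A : 'I_n -> set T) :
  (forall i, measurable (A i)) ->
  lebesgue_tuple [set t : n.-tuple T | forall i, A i (tnth t i)] =
  (\prod_(i < n) lebesgue_measure (A i))%E.
Proof.
elim: n A => [|n IHn] A mA.
  by rewrite big_ord0 /= diracE mem_set// => -[].
rewrite big_ord_recl /= /pushforward preimage_cons_pair.
have [m mE] := lebesgue_tuple_sigma_finite n.
rewrite mE product_measure1E//; last first.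
  exact: (@measurable_tuple_box _ (fun i => A (lift ord0 i))).
by rewrite -mE (IHn (fun i => A (lift ord0 i))).
Qed.

End lebesgue_tuple_theory.

(* Main.v *)
Require Import Defs.
From HB Require Import structures.
From mathcomp Require Import all_boot all_order all_algebra.
From mathcomp Require Import all_classical all_reals all_analysis.
From mathcomp Require Import measurable_realfun ring lra.

Set Implicit Arguments.
Unset Strict Implicit.
Unset Printing Implicit Defensive.

Import Order.TTheory GRing.Theory Num.Theory.
Import numFieldNormedType.Exports.

Local Open Scope classical_set_scope.
Local Open Scope ring_scope.

(* With phi(x) = max(|x| - A, 0)^2 the squared distance from x to [-A, A], the
   volume in question is that of V_n = {t | sum_i phi(t_i) <= n nu}.  By Tonelli
   the Laplace transform of sum_i phi(t_i) at pi / q^2 is the n-th power of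
   int exp(- pi phi(x) / q^2) dx = 2 A + q, which gives the Chernoff bound
   (1/n) log |V_n| <= pi nu / q^2 + log(2 A + q) for all q > 0.  The matching
   lower bound is Cramer's: tilt by exp(- pi phi / q^2) with the tilted mean of
   phi slightly below nu; the two tails of the tilted measure are again
   controlled by the Laplace transform at neighbouring parameters, so no law of
   large numbers is needed.  The optimal q satisfies
   q^3 / (2 pi (2 A + q)) = nu, and theta = q / (2 A + q) turns this into the
   stated equation.  Continuity follows from the bound above, which makes the
   exponent an infimum of affine functions of nu whose slope at the optimum is
   at most 1 / (2 nu); at nu = 0 one takes q = nu^(1/4). *)

(** * Squared distance to the cube and its Laplace transform *)

Definition sqdist (R : realType) (A x : R) : R := Num.max (`|x| - A) 0 ^+ 2.

Definition sqdist_tuple (R : realType) (A : R) (n : nat)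
    (t : n.-tuple (measurableTypeR R)) : R :=
  \sum_(i < n) sqdist A (tnth t i).

Section sqdist_theory.
Variables (R : realType) (A : R).
Hypothesis A0 : 0 < A.
Local Notation T := (measurableTypeR R).

Lemma sqdist_ge0 (x : R) : 0 <= sqdist A x.
Proof. exact: sqr_ge0. Qed.

Lemma sqdistN (x : R) : sqdist A (- x) = sqdist A x.
Proof. by rewrite /sqdist normrN. Qed.

Lemma sqdist_in (x : R) : `|x| <= A -> sqdist A x = 0.
Proof. by move=> xA; rewrite /sqdist max_r ?subr_le0// expr0n. Qed.

Lemma sqdist_out (x : R) : A <= x -> sqdist A x = (x - A) ^+ 2.
Proof.
move=> Ax; rewrite /sqdist ger0_norm ?max_l ?subr_ge0//.
exact: le_trans (ltW A0) Ax.
Qed.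

Lemma continuous_sqdist : continuous (sqdist A).
Proof.
move=> x; apply: (@continuous_comp _ _ _ (fun x : R => Num.max (`|x| - A) 0)
  (fun y : R => y ^+ 2)); last exact: exprn_continuous.
apply: continuous_max; last exact: cvg_cst.
apply: cvgB; last exact: cvg_cst.
exact: norm_continuous.
Qed.

Lemma sqdist_le_sqr (x y : R) : `|x| <= A -> sqdist A (x + y) <= y ^+ 2.
Proof.
move=> xA; rewrite /sqdist -[leRHS]real_normK ?num_real// lerXn2r ?nnegrE ?normr_ge0//.
  by rewrite le_max lexx orbT.
rewrite ge_max normr_ge0 andbT lerBlDr.
by apply: le_trans (ler_normD _ _) _; rewrite addrC lerD2l.
Qed.

(** The witness is the projection of [x] onto [[-A, A]]: [x] itself or the nearer endpoint. *)
Lemma sqdist_attained (x : R) :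
  exists2 y, - A <= y <= A & (x - y) ^+ 2 = sqdist A x.
Proof.
have [xA|xA] := lerP `|x| A.
  by exists x; rewrite -?ler_norml// sqdist_in// subrr expr0n.
have [x0|x0] := leP 0 x.
  exists A; first by rewrite lexx andbT lerNl (le_trans _ (ltW A0))// oppr_le0 ltW.
  by rewrite sqdist_out// ltW// -(ger0_norm x0).
exists (- A); first by rewrite lexx /= lerNl (le_trans _ (ltW A0))// oppr_le0 ltW.
rewrite opprK -sqdistN sqdist_out; first by rewrite -sqrrN opprD.
by rewrite ltW// -(ltr0_norm x0).
Qed.

(** The cube is a product, so the squared Euclidean distance to it is minimised coordinate by
    coordinate, and the nearest point is attained. *)
Lemma minkowski_sum_cube_eballE (n : nat) (r : R) : 0 <= r ->
  minkowski_sum (cube n A) (eball n r) =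
  [set x : 'rV[R]_n | \sum_(i < n) sqdist A (x ord0 i) <= r ^+ 2].
Proof.
move=> r0; apply/seteqP; split=> [_ [x xA [y yr <-]]|x] /=.
  apply: (@le_trans _ _ (\sum_(i < n) y ord0 i ^+ 2)).
    apply: ler_sum => i _; rewrite mxE sqdist_le_sqr// ler_norml; exact: xA.
  by rewrite -(@ler_sqrt _ _ (r ^+ 2)) ?sqr_ge0// sqrtr_sqr ger0_norm.
move=> xr; have /choice[y yE] : forall i : 'I_n, exists y,
    - A <= y <= A /\ (x ord0 i - y) ^+ 2 = sqdist A (x ord0 i).
  by move=> i; have [y] := sqdist_attained (x ord0 i); exists y.
exists (\row_i y i); first by move=> i; rewrite mxE; exact: (yE i).1.
exists (x - \row_i y i); last by rewrite addrC subrK.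
rewrite /eball /norm2 /=.
rewrite -(ger0_norm r0) -sqrtr_sqr ler_sqrt ?sqr_ge0//.
apply: le_trans xr; apply: ler_sum => i _.
by rewrite !mxE (yE i).2.
Qed.

Lemma Vol_minkowski_sum (n : nat) (nu : R) : 0 <= nu ->
  Vol (minkowski_sum (cube n A) (eball n (Num.sqrt (n%:R * nu)))) =
  lebesgue_tuple [set t : n.-tuple T | sqdist_tuple A t <= n%:R * nu].
Proof.
move=> nu0; rewrite /Vol minkowski_sum_cube_eballE ?sqrtr_ge0//.
rewrite sqr_sqrtr ?mulr_ge0//; congr lebesgue_tuple.
apply/seteqP; split=> t /=; rewrite /sqdist_tuple.
  by under eq_bigr do rewrite mxE.
by under [X in _ -> X <= _]eq_bigr do rewrite mxE.
Qed.

Lemma measurable_sqdist_tuple (n : nat) :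
  measurable_fun setT (@sqdist_tuple R A n).
Proof.
apply: measurable_sum => i; apply: (measurableT_comp (f := sqdist A)).
  by apply: continuous_measurable_fun; exact: continuous_sqdist.
exact: measurable_tnth.
Qed.

Local Notation mu := (@lebesgue_measure R).

(** The substitution [x = q / sqrt pi * y + A] reduces this to the half-line Gaussian integral
    [sqrt pi / 2]. *)
Lemma integral_expR_half_line (q : R) : 0 < q ->
  (\int[mu]_(x in `[A, +oo[) (expR (- (pi / q ^+ 2) * (x - A) ^+ 2))%:E)%E =
  (q / 2)%:E.
Proof.
move=> q0; have pi0 := pi_gt0 R.
have sp0 : 0 < Num.sqrt pi :> R by rewrite sqrtr_gt0.
pose s := q / Num.sqrt pi; have s0 : 0 < s by rewrite divr_gt0.
pose F := fun y : R => s * y + A.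
have dF (y : R) : is_derive y (1 : R) F s.
  apply: is_derive_eq.
  by rewrite addr0 scaler1.
have F'E : derive1 F = cst s.
  by apply/funext => y; rewrite derive1E derive_val.
have F0 : F 0 = A by rewrite /F mulr0 add0r.
have cF : continuous F.
  by move=> y; apply/differentiable_continuous/derivable1_diffP; exact: ex_derive.
rewrite -{1}F0 increasing_ge0_integration_by_substitutiony.
- transitivity (\int[mu]_(x in `[0%R, +oo[) (s%:E * (gauss_fun x)%:E))%E.
    apply: eq_integral => x _; rewrite F'E -EFinM mulrC; congr EFin; congr (_ * expR _).
    rewrite /F addrK exprMn /s expr_div_n sqr_sqrtr ?ltW// mulrA.
    have K (p : R) : 0 < p ->
        - (p / q ^+ 2) * (q ^+ 2 / p) * x ^+ 2 = - x ^+ 2.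
      by move=> p0; field; rewrite !gt_eqF.
    exact: K.
  rewrite ge0_integralZl//.
  + rewrite integral0y_gauss -EFinM; congr EFin.
    by rewrite /s; field; rewrite gt_eqF.
  + by apply/measurable_EFinP/measurable_funTS; exact: measurable_gauss_fun.
  + by move=> x _; rewrite lee_fin expR_ge0.
  + by rewrite lee_fin ltW.
- by move=> x y _ _ xy; rewrite /F ltrD2r ltr_pM2l.
- by rewrite F'E => x _; exact: cvg_cst.
- by rewrite F'E; exact: is_cvg_cst.
- by rewrite F'E; exact: is_cvg_cst.
- split; first by move=> x _; exact: ex_derive.
  by apply: cvg_at_right_filter; exact: cF.
- apply/cvgryPge => M; near=> x.
  rewrite /F -lerBlDr -ler_pdivrMl//.
- apply: continuous_subspaceT => x.
  apply: continuous_comp; last exact: continuous_expR.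
  apply: cvgM; first exact: cvg_cst.
  apply: (@continuous_comp _ _ _ (fun x : R => x - A) (fun y : R => y ^+ 2));
    last exact: exprn_continuous.
  by apply: cvgB; [exact: cvg_id|exact: cvg_cst].
- by move=> x _; exact: expR_ge0.
Unshelve. all: by end_near. Qed.

(** By symmetry the integral is twice that over the half-line, where the flat part gives [A] and the
    Gaussian tail [q / 2]. Writing the rate as [pi / q ^+ 2] makes the transform affine in [q]. *)
Lemma integral_expR_sqdist (q : R) : 0 < q ->
  (\int[mu]_x (expR (- (pi / q ^+ 2) * sqdist A x))%:E)%E = (2 * A + q)%:E.
Proof.
move=> q0; set f := fun x => expR (- (pi / q ^+ 2) * sqdist A x).
have cf : continuous f.
  move=> x; apply: continuous_comp; last exact: continuous_expR.
  by apply: cvgM; [exact: cvg_cst|exact: continuous_sqdist].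
have mf (D : set T) : measurable_fun D (EFin \o f : T -> \bar R).
  apply/measurable_EFinP; apply: measurable_funTS.
  exact: continuous_measurable_fun.
rewrite (@ge0_symfun_integralT _ f)//; last 2 first.
- by move=> x; exact: expR_ge0.
- by move=> x; rewrite /f /= sqdistN.
have -> : [set x : R | 0 <= x] = `[0, A[ `|` `[A, +oo[.
  apply/seteqP; split=> x /=; rewrite !in_itv/= andbT.
    by move=> ->; case: (ltP x A) => _; [left|right].
  by case=> [/andP[]//|]; exact/le_trans/ltW.
rewrite ge0_integral_setU//=; last 2 first.
- by move=> x _; rewrite lee_fin expR_ge0.
- apply/disj_setPS => x /= [].
  by rewrite !in_itv/= andbT => /andP[_ xA]; rewrite leNgt xA.
rewrite (eq_integral (cst 1%E)); last first.
  move=> x; rewrite inE/= in_itv/= => /andP[x0 xA].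
  by rewrite /f sqdist_in ?mulr0 ?expR0// ger0_norm// ltW.
rewrite integral_cst// mul1e.
transitivity (2%:E * (A%:E + (q / 2)%:E))%E; last first.
  by rewrite -EFinD -EFinM; congr EFin; field.
congr (_ * (_ + _))%E.
  by rewrite [LHS]lebesgue_measure_itv/= lte_fin A0 oppr0 adde0.
rewrite -(integral_expR_half_line q0); apply: eq_integral => x.
by rewrite inE/= in_itv/= andbT => Ax; rewrite /f sqdist_out.
Qed.

Lemma sqdist_tuple_cons (n : nat) (p : T * n.-tuple T) :
  sqdist_tuple A (cons_pair p) = sqdist A p.1 + sqdist_tuple A p.2.
Proof.
rewrite /sqdist_tuple big_ord_recl/= tnth0; congr (_ + _).
by apply: eq_bigr => i _; rewrite tnthS !(tnth_nth (0 : T)).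
Qed.

(** The exponential of a sum factors, so Tonelli and induction on [n] apply. The variable [m]
    packages the bare set function [lebesgue_tuple] as a measure that can be integrated against. *)
Lemma integral_expR_sqdist_tuple (q : R) (n : nat)
    (m : {sigma_finite_measure set (n.-tuple T) -> \bar R}) : 0 < q ->
  @lebesgue_tuple R n = m ->
  (\int[m]_t (expR (- (pi / q ^+ 2) * sqdist_tuple A t))%:E)%E =
  ((2 * A + q) ^+ n)%:E.
Proof.
move=> q0; set c := - (pi / q ^+ 2).
have Em k : measurable_fun setT
    (fun t : k.-tuple T => (expR (c * sqdist_tuple A t))%:E : \bar R).
  apply/measurable_EFinP/measurableT_comp => //.
  by apply: measurable_funM => //; exact: measurable_sqdist_tuple.
elim: n m => [|n IHn] m mE.
  rewrite (eq_integral (cst 1%E)); last first.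
    by move=> t _; rewrite /sqdist_tuple big_ord0 mulr0 expR0.
  rewrite integral_cst// mul1e expr0.
  suff : lebesgue_tuple [set: 0.-tuple T] = 1%E :> \bar R by rewrite mE.
  exact: diracT.
have [m' m'E] := lebesgue_tuple_sigma_finite R n.
have inner (x : T) :
    (\int[m']_t (expR (c * sqdist_tuple A (cons_pair (x, t))))%:E =
     ((2 * A + q) ^+ n)%:E * (expR (c * sqdist A x))%:E)%E.
  transitivity (\int[m']_t
      ((expR (c * sqdist A x))%:E * (expR (c * sqdist_tuple A t))%:E))%E.
    by apply: eq_integral => t _; rewrite sqdist_tuple_cons mulrDr expRD EFinM.
  by rewrite ge0_integralZl//; [rewrite IHn// muleC|exact: Em].
(* Replaces the abstract [m] by the recursive description of [lebesgue_tuple], so that the integral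
   unfolds over the product. *)
rewrite (eq_measure_integral (pushforward (mu \x m')%E (@cons_pair T n))); last 2 first.
- move=> mc; rewrite ge0_integral_pushforward//.
  rewrite preimage_setT fubini_tonelli1//=.
  + rewrite /fubini_F /=.
    under eq_integral do rewrite inner.
    rewrite ge0_integralZl//= ?integral_expR_sqdist// -?EFinM ?exprSr//.
    * apply/measurable_EFinP/measurableT_comp => //.
      apply: measurable_funM => //; apply: continuous_measurable_fun.
      exact: continuous_sqdist.
    * by rewrite lee_fin exprn_ge0// addr_ge0 ?mulr_ge0 ?ltW.
  + apply: (measurableT_comp (Em n.+1)); exact: measurable_cons_pair.
  + exact: Em.
- move=> mc B _ _; transitivity (lebesgue_tuple B); first by rewrite mE.
  by rewrite /= m'E.
- exact: measurable_cons_pair.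
Qed.

End sqdist_theory.

(** * Exponential bounds for sublevel sets over an arbitrary measure *)

Section laplace_bounds.
Context d (T : measurableType d) (R : realType).
Variables (m : {measure set T -> \bar R}) (f : T -> R).
Hypothesis mf : measurable_fun setT f.

Local Lemma measurable_sublevel (t : R) : measurable [set x | f x <= t].
Proof.
rewrite -[X in measurable X]setTI.
rewrite (_ : [set x | f x <= t] = f @^-1` `]-oo, t]); first exact: mf.
by apply/seteqP; split=> x /=; rewrite in_itv.
Qed.

Local Lemma measurable_expR_fun (k : R) :
  measurable_fun setT (fun x => (expR (k * f x))%:E : \bar R).
Proof.
by apply/measurable_EFinP/measurableT_comp => //; exact: measurable_funM.
Qed.

(** Markov's argument: the constant lies below the exponential on the sublevel set, and enlarging
    the domain only increases the integral. *)
Lemma chernoff_bound (c t : R) : 0 <= c ->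
  ((expR (- c * t))%:E * m [set x | (f x <= t)%R] <=
   \int[m]_x (expR (- c * f x))%:E)%E.
Proof.
move=> c0; have mS := measurable_sublevel t.
rewrite -integral_cst//.
apply: (@le_trans _ _ (\int[m]_(x in [set x | (f x <= t)%R])
  (expR (- c * f x))%:E)%E).
  apply: ge0_le_integral => //.
  - by move=> x _; rewrite lee_fin expR_ge0.
  - exact: measurable_funTS (measurable_expR_fun _).
  - by move=> x ft; rewrite lee_fin ler_expR !mulNr lerN2 ler_wpM2l.
by apply: ge0_subset_integral => //; exact: measurable_expR_fun.
Qed.

(* Exponential tilting: outside the window [s <= f <= t], the integrand is
   dominated by the same exponential with a shifted rate, so the mass of the
   tilted measure outside the window is controlled by two other values of the
   Laplace transform. *)
Lemma laplace_tilting (c a b s t : R) : 0 <= c -> 0 <= a -> 0 <= b ->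
  (\int[m]_x (expR (- c * f x))%:E <=
   (expR (- c * s))%:E * m [set x | (f x <= t)%R] +
   (expR (- a * t))%:E * \int[m]_x (expR (- (c - a) * f x))%:E +
   (expR (b * s))%:E * \int[m]_x (expR (- (c + b) * f x))%:E)%E.
Proof.
move=> c0 a0 b0; set S := [set x | (f x <= t)%R].
have mS : measurable S by exact: measurable_sublevel.
have mI : measurable_fun setT (fun x => (\1_S x)%:E : \bar R).
  by apply/measurable_EFinP; exact: measurable_indic.
have mE k := measurable_expR_fun k.
have -> : m S = (\int[m]_x (\1_S x)%:E)%E by rewrite integral_indic// setIT.
have Z (k : R) (g : T -> R) : 0 <= k -> (forall x, 0 <= g x) ->
    measurable_fun setT (fun x => (g x)%:E : \bar R) ->
    (k%:E * \int[m]_x (g x)%:E = \int[m]_x (k * g x)%:E)%E.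
  move=> k0 g0 mg; rewrite -ge0_integralZl// => x _; rewrite lee_fin; exact: g0.
have M (k : R) (g : T -> R) : measurable_fun setT (fun x => (g x)%:E : \bar R) ->
    measurable_fun setT (fun x => (k * g x)%:E : \bar R).
  by move=> /measurable_EFinP mg; apply/measurable_EFinP; exact: measurable_funM.
rewrite !Z ?expR_ge0//; try (by move=> x; rewrite ?expR_ge0).
have I0 x : 0 <= expR (- c * s) * \1_S x by rewrite mulr_ge0 ?expR_ge0.
have E0 u v x : 0 <= expR u * expR (v * f x) by rewrite mulr_ge0 ?expR_ge0.
rewrite -ge0_integralD//; [|exact: M|exact: M].
rewrite -ge0_integralD//; [|by move=> x _; rewrite adde_ge0|
  by apply: emeasurable_funD; exact: M|exact: M].
apply: ge0_le_integral => //.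
  by apply: emeasurable_funD; [apply: emeasurable_funD|]; exact: M.
(* Pointwise, a single summand suffices: the second if [t < f x], the first if [s <= f x <= t], the
   third if [f x] is below both [s] and [t]. *)
move=> x _; rewrite -!EFinD lee_fin -!expRD.
have [ft|tf] := leP (f x) t; last first.
  have -> : \1_S x = 0 :> R.
    by rewrite indicE memNset// /S /= => /le_lt_trans/(_ tf); rewrite ltxx.
  rewrite mulr0 add0r -[leLHS]addr0 lerD ?expR_ge0// ler_expR.
  by have := ler_wpM2l a0 (ltW tf); lra.
rewrite indicE mem_set//= mulr1.
have [sf|fs] := leP s (f x).
  rewrite -[leLHS]addr0 lerD ?expR_ge0//.
  rewrite -[leLHS]addr0 lerD ?expR_ge0// ler_expR.
  by have := ler_wpM2l c0 sf; lra.
rewrite -[leLHS]add0r lerD ?addr_ge0 ?expR_ge0// ler_expR.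
by have := ler_wpM2l b0 (ltW fs); lra.
Qed.

End laplace_bounds.

(** * Exponential upper and lower bounds for the volume *)

Section volume_growth.
Variables (R : realType) (A : R).
Hypothesis A0 : 0 < A.
Local Notation T := (measurableTypeR R).

Definition sublevel_volume (n : nat) (nu : R) : \bar R :=
  lebesgue_tuple [set t : n.-tuple T | sqdist_tuple A t <= n%:R * nu].

Local Lemma rate_ge0 (q : R) : 0 <= pi / q ^+ 2.
Proof. by rewrite divr_ge0 ?pi_ge0 ?sqr_ge0. Qed.

Local Lemma rate_lt (q p : R) : 0 < q -> q < p -> pi / p ^+ 2 < pi / q ^+ 2.
Proof.
move=> q0 qp; rewrite ltr_pM2l ?pi_gt0// ltf_pV2 ?posrE ?exprn_gt0//.
  by rewrite ltrXn2r// ?nnegrE ltW// (lt_trans q0).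
exact: lt_trans qp.
Qed.

Lemma sublevel_volume_ge0 (n : nat) (nu : R) : (0 <= sublevel_volume n nu)%E.
Proof.
rewrite /sublevel_volume; have [m ->] := lebesgue_tuple_sigma_finite R n.
exact: measure_ge0.
Qed.

Lemma sublevel_volume_le (n : nat) (nu q : R) : 0 < q ->
  (sublevel_volume n nu <=
   (expR (n%:R * (pi / q ^+ 2 * nu)) * (2 * A + q) ^+ n)%:E)%E.
Proof.
move=> q0; rewrite /sublevel_volume.
have [m mE] := lebesgue_tuple_sigma_finite R n.
have := chernoff_bound m (@measurable_sqdist_tuple R A n)
  (n%:R * nu) (rate_ge0 q).
rewrite (integral_expR_sqdist_tuple A0 q0 mE) mE => H.
have E : expR (- (pi / q ^+ 2) * (n%:R * nu)) *
    expR (n%:R * (pi / q ^+ 2 * nu)) = 1.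
  by rewrite -expRD [X in expR X](_ : _ = 0) ?expR0//; ring.
rewrite -(@lee_pmul2l _ (expR (- (pi / q ^+ 2) * (n%:R * nu)))%:E)//.
  by rewrite -EFinM (mulrA (expR _)) E mul1r.
by rewrite lte_fin expR_gt0.
Qed.

(** Any parameter in the Chernoff bound gives finiteness; [q = 1] is taken. *)
Lemma sublevel_volume_fin (n : nat) (nu : R) :
  sublevel_volume n nu = (fine (sublevel_volume n nu))%:E.
Proof.
rewrite fineK// ge0_fin_numE ?sublevel_volume_ge0//.
exact: le_lt_trans (sublevel_volume_le n nu ltr01) (ltry _).
Qed.

(** Tilting at rate [pi / q ^+ 2] with window from [n mu] to [n nu]. The shifts are chosen so that
    the shifted rates are [pi / p ^+ 2] and [pi / r ^+ 2], whose transforms are again explicit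
    [n]-th powers. *)
Lemma sublevel_volume_tilting (n : nat) (nu mu r q p : R) :
  0 < r -> r < q -> q < p ->
  (2 * A + q) ^+ n <=
    expR (- n%:R * (pi / q ^+ 2 * mu)) * fine (sublevel_volume n nu) +
    (expR (- (pi / q ^+ 2 - pi / p ^+ 2) * nu) * (2 * A + p)) ^+ n +
    (expR ((pi / r ^+ 2 - pi / q ^+ 2) * mu) * (2 * A + r)) ^+ n.
Proof.
move=> r0 rq qp; have q0 := lt_trans r0 rq; have p0 := lt_trans q0 qp.
have [m mE] := lebesgue_tuple_sigma_finite R n.
have a0 : 0 <= pi / q ^+ 2 - pi / p ^+ 2 by rewrite subr_ge0 ltW// rate_lt.
have b0 : 0 <= pi / r ^+ 2 - pi / q ^+ 2 by rewrite subr_ge0 ltW// rate_lt.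
have := laplace_tilting m (@measurable_sqdist_tuple R A n)
  (n%:R * mu) (n%:R * nu) (rate_ge0 q) a0 b0.
rewrite subKr addrCA subrr addr0 !(integral_expR_sqdist_tuple A0 _ mE)//.
rewrite [X in (_ <= _ * X + _ + _)%E](_ : _ =
  (fine (sublevel_volume n nu))%:E); last first.
  by rewrite -sublevel_volume_fin /sublevel_volume mE.
rewrite -!EFinM -!EFinD lee_fin !exprMn -!expRM_natl => H.
by move: H; congr (is_true (_ <= expR _ * _ + expR _ * _ + expR _ * _)); ring.
Qed.

(* [tilted_mean q] is [- d/d lambda ln(2 A + sqrt (pi / lambda))] at
   [lambda = pi / q^2], the mean of [sqdist] under the tilted law. *)
Definition tilted_mean (q : R) : R := q ^+ 3 / (2 * pi * (2 * A + q)).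

(** Concavity of the logarithm, obtained from [ln (1 + x) <= x]. *)
Local Lemma ln_tangent (q p : R) : 0 < q -> 0 < p ->
  ln (2 * A + p) <= ln (2 * A + q) + (p - q) / (2 * A + q).
Proof.
move=> q0 p0; have Zq : 0 < 2 * A + q by rewrite addr_gt0// mulr_gt0.
have Zp : 0 < 2 * A + p by rewrite addr_gt0// mulr_gt0.
rewrite -lerBlDl -ln_div ?posrE//.
have -> : (2 * A + p) / (2 * A + q) = 1 + (p - q) / (2 * A + q).
  by field; rewrite gt_eqF.
apply: le_ln1Dx.
rewrite -subr_gt0 (_ : _ - _ = (2 * A + p) / (2 * A + q)) ?divr_gt0//.
by field; rewrite gt_eqF.
Qed.

(** The expression is the secant slope [(1 / p^2 - 1 / q^2) / (q - p)], and the limit is minus the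
    derivative of [1 / q^2]. *)
Local Lemma cvg_secant (q : R) : 0 < q ->
  (q + p) / (p ^+ 2 * q ^+ 2) @[p --> q] --> 2 / q ^+ 3.
Proof.
move=> q0; have -> : 2 / q ^+ 3 = (q + q) / (q ^+ 2 * q ^+ 2) :> R.
  by field; rewrite gt_eqF.
apply: cvgM; first by apply: cvgD; [exact: cvg_cst|exact: cvg_id].
apply: cvgV; first by rewrite mulf_neq0// sqrf_eq0 gt_eqF.
by apply: cvgMl; exact: exprn_continuous.
Qed.

(** The right-hand side says that [pi x / p^2 + ln (2 A + p)] has positive derivative in [p] at
    [p = q]. *)
Local Lemma tilted_mean_ltE (q x : R) : 0 < q ->
  (x < tilted_mean q) = (pi * x * (2 / q ^+ 3) < (2 * A + q)^-1).
Proof.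
move=> q0; have Zq : 0 < 2 * A + q by rewrite addr_gt0// mulr_gt0.
have pi0 := pi_gt0 R; have q30 : 0 < q ^+ 3 by rewrite exprn_gt0.
rewrite /tilted_mean ltr_pdivlMr ?mulr_gt0// -[X in _ = (_ < X)]mul1r.
rewrite ltr_pdivlMr// [X in _ = (X < _)](_ : _ =
  x * (2 * pi * (2 * A + q)) / q ^+ 3); last by ring.
by rewrite ltr_pdivrMr// mul1r.
Qed.

Local Lemma tilted_mean_gtE (q x : R) : 0 < q ->
  (tilted_mean q < x) = ((2 * A + q)^-1 < pi * x * (2 / q ^+ 3)).
Proof.
move=> q0; have Zq : 0 < 2 * A + q by rewrite addr_gt0// mulr_gt0.
have pi0 := pi_gt0 R; have q30 : 0 < q ^+ 3 by rewrite exprn_gt0.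
rewrite /tilted_mean ltr_pdivrMr ?mulr_gt0// -[X in _ = (X < _)]mul1r.
rewrite ltr_pdivrMr// [X in _ = (_ < X)](_ : _ =
  x * (2 * pi * (2 * A + q)) / q ^+ 3); last by ring.
by rewrite ltr_pdivlMr// mul1r.
Qed.

(** Since [pi mu / r^2 + ln (2 A + r)] has positive derivative at [r = q], it drops just to the left
    of [q]. The tangent bound on [ln] and the secant slope replace differentiation. *)
Lemma lower_tail_decay (q mu : R) : 0 < q -> mu < tilted_mean q ->
  exists2 r, 0 < r < q &
    expR ((pi / r ^+ 2 - pi / q ^+ 2) * mu) * (2 * A + r) < 2 * A + q.
Proof.
move=> q0 muq; have Zq : 0 < 2 * A + q by rewrite addr_gt0// mulr_gt0.
have : (pi * mu * ((q + r) / (r ^+ 2 * q ^+ 2))) @[r --> q^'-] -->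
    pi * mu * (2 / q ^+ 3).
  by apply: cvgMr; apply: cvg_at_left_filter; exact: cvg_secant.
rewrite tilted_mean_ltE// in muq => cv.
near q^'- => r.
have r0 : 0 < r by near: r; exact: nbhs_left_gt.
have rq : r < q by [].
have Zr : 0 < 2 * A + r by rewrite addr_gt0// mulr_gt0.
have H : pi * mu * ((q + r) / (r ^+ 2 * q ^+ 2)) < (2 * A + q)^-1.
  by near: r; exact: cvgr_lt cv _ muq.
exists r; first by rewrite r0.
rewrite -[X in _ * X](lnK _) ?posrE// -expRD -[ltRHS](lnK _) ?posrE//.
rewrite ltr_expR; have L := ln_tangent q0 r0.
apply: le_lt_trans (lerD (lexx _) L) _.
rewrite addrCA gtrDl (_ : pi / r ^+ 2 - pi / q ^+ 2 =
  pi * ((q + r) / (r ^+ 2 * q ^+ 2)) * (q - r)); last first.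
  by move: (pi : R) => pp; field; rewrite !gt_eqF.
rewrite -(opprB q r) mulNr subr_lt0 mulrAC mulrC mulrA ltr_pM2l ?subr_gt0//.
by move: H; congr (is_true (_ < _)); ring.
Unshelve. all: by end_near. Qed.

(** Mirror image: the derivative is now negative, so [p] is taken just to the right of [q]. *)
Lemma upper_tail_decay (q nu : R) : 0 < q -> tilted_mean q < nu ->
  exists2 p, q < p &
    expR (- (pi / q ^+ 2 - pi / p ^+ 2) * nu) * (2 * A + p) < 2 * A + q.
Proof.
move=> q0 muq; have Zq : 0 < 2 * A + q by rewrite addr_gt0// mulr_gt0.
have : (pi * nu * ((q + r) / (r ^+ 2 * q ^+ 2))) @[r --> q^'+] -->
    pi * nu * (2 / q ^+ 3).
  by apply: cvgMr; apply: cvg_at_right_filter; exact: cvg_secant.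
rewrite tilted_mean_gtE// in muq => cv.
near q^'+ => r.
have qr : q < r by [].
have r0 : 0 < r by exact: lt_trans qr.
have Zr : 0 < 2 * A + r by rewrite addr_gt0// mulr_gt0.
have H : (2 * A + q)^-1 < pi * nu * ((q + r) / (r ^+ 2 * q ^+ 2)).
  by near: r; exact: cvgr_gt cv _ muq.
exists r => //.
rewrite -[X in _ * X](lnK _) ?posrE// -expRD -[ltRHS](lnK _) ?posrE//.
rewrite ltr_expR; have L := ln_tangent q0 r0.
apply: le_lt_trans (lerD (lexx _) L) _.
rewrite addrCA gtrDl (_ : pi / q ^+ 2 - pi / r ^+ 2 =
  pi * ((q + r) / (r ^+ 2 * q ^+ 2)) * (r - q)); last first.
  by move: (pi : R) => pp; field; rewrite !gt_eqF.
rewrite mulNr addrC subr_lt0 mulrAC [ltRHS]mulrC ltr_pM2l ?subr_gt0//.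
by rewrite mulrAC.
Unshelve. all: by end_near. Qed.

(** Relative to [(2 A + q) ^+ n] the two tails are geometric sequences with ratios below 1. Once
    each is below 1/4, the window carries at least half of the tilted mass. *)
Lemma sublevel_volume_growth (q mu nu c : R) : 0 < q ->
  mu < tilted_mean q -> tilted_mean q < nu ->
  c < pi / q ^+ 2 * mu + ln (2 * A + q) ->
  \forall n \near \oo, 0 < fine (sublevel_volume n nu) /\
    c <= n%:R^-1 * ln (fine (sublevel_volume n nu)).
Proof.
move=> q0 muq nuq cq; have Zq : 0 < 2 * A + q by rewrite addr_gt0// mulr_gt0.
have [r /andP[r0 rq] Hr] := lower_tail_decay q0 muq.
have [p qp Hp] := upper_tail_decay q0 nuq.
have p0 := lt_trans q0 qp.
pose rho1 := expR (- (pi / q ^+ 2 - pi / p ^+ 2) * nu) * (2 * A + p) / (2 * A + q).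
pose rho2 := expR ((pi / r ^+ 2 - pi / q ^+ 2) * mu) * (2 * A + r) / (2 * A + q).
have rho1_ge0 : 0 <= rho1.
  by rewrite /rho1 divr_ge0 ?mulr_ge0 ?expR_ge0 ?addr_ge0 ?mulr_ge0// ltW.
have rho2_ge0 : 0 <= rho2.
  by rewrite /rho2 divr_ge0 ?mulr_ge0 ?expR_ge0 ?addr_ge0 ?mulr_ge0// ltW.
have c1 : rho1 ^+ n @[n --> \oo] --> (0 : R).
  by apply: cvg_expr; rewrite ger0_norm// ltr_pdivrMr// mul1r.
have c2 : rho2 ^+ n @[n --> \oo] --> (0 : R).
  by apply: cvg_expr; rewrite ger0_norm// ltr_pdivrMr// mul1r.
have q14 : 0 < 4^-1 :> R by rewrite invr_gt0.
set k := pi / q ^+ 2 * mu + ln (2 * A + q) in cq.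
have kc : 0 < k - c by rewrite subr_gt0.
near=> n.
have n0 : (0 < n)%N by near: n; exact: nbhs_infty_gt.
have R1 : rho1 ^+ n < 4^-1 by near: n; exact: cvgr_lt c1 _ q14.
have R2 : rho2 ^+ n < 4^-1 by near: n; exact: cvgr_lt c2 _ q14.
(* From here on the gap [k - c] absorbs the [ln 2 / n] lost through the factor 1/2. *)
have nk : ln 2 / (k - c) <= n%:R :> R by near: n; exact: nbhs_infty_ger.
have := sublevel_volume_tilting n nu mu r0 rq qp.
set v := fine _.
have E1 : (expR (- (pi / q ^+ 2 - pi / p ^+ 2) * nu) * (2 * A + p)) ^+ n =
    rho1 ^+ n * (2 * A + q) ^+ n.
  by rewrite -exprMn /rho1 divfK// gt_eqF.
have E2 : (expR ((pi / r ^+ 2 - pi / q ^+ 2) * mu) * (2 * A + r)) ^+ n =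
    rho2 ^+ n * (2 * A + q) ^+ n.
  by rewrite -exprMn /rho2 divfK// gt_eqF.
have E3 : (2 * A + q) ^+ n = expR (n%:R * ln (2 * A + q)).
  by rewrite expRM_natl lnK.
rewrite E1 E2 E3; set W := expR (n%:R * _); have W0 : 0 < W by exact: expR_gt0.
move=> H.
have G : W / 2 <= expR (- n%:R * (pi / q ^+ 2 * mu)) * v.
  have := ler_pM2r W0 (rho1 ^+ n) 4^-1; rewrite (ltW R1) => G1.
  have := ler_pM2r W0 (rho2 ^+ n) 4^-1; rewrite (ltW R2) => G2.
  by lra.
have {}G : expR (n%:R * k - ln 2) <= v.
  rewrite -(ler_pM2l (expR_gt0 (- n%:R * (pi / q ^+ 2 * mu)))).
  apply: le_trans G; rewrite -expRD /W -[X in expR _ / X](@lnK R) ?posrE//.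
  by rewrite -expRN -expRD ler_expR /k; lra.
have v0 : 0 < v by apply: lt_le_trans G; exact: expR_gt0.
split=> //.
rewrite mulrC ler_pdivlMr ?ltr0n// -ler_expR lnK ?posrE//.
apply: le_trans G; rewrite ler_expR.
by move: nk; rewrite ler_pdivrMr//; lra.
Unshelve. all: by end_near. Qed.

End volume_growth.

(** * The limiting exponent, its continuity, and the entropy formula *)

Section exponent.
Variables (R : realType) (A : R).
Hypothesis A0 : 0 < A.

(** The Chernoff exponent [pi / q ^+ 2 * nu + ln (2 A + q)] at [nu = tilted_mean A q], simplified;
    see [growth_rateE]. *)
Definition growth_rate (q : R) : R := q / (2 * (2 * A + q)) + ln (2 * A + q).

Local Lemma Z_gt0 (q : R) : 0 < q -> 0 < 2 * A + q.
Proof. by move=> q0; rewrite addr_gt0// mulr_gt0. Qed.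

Lemma tilted_mean_gt0 (q : R) : 0 < q -> 0 < tilted_mean A q.
Proof.
by move=> q0; rewrite divr_gt0 ?exprn_gt0// !mulr_gt0 ?pi_gt0// Z_gt0.
Qed.

Local Lemma rate_tilted_mean (q : R) : 0 < q ->
  pi / q ^+ 2 * tilted_mean A q = q / (2 * (2 * A + q)).
Proof.
move=> q0; have := pi_gt0 R; have := Z_gt0 q0; rewrite /tilted_mean.
by move: (pi : R) => p Z0 p0; field; rewrite !gt_eqF.
Qed.

Lemma growth_rateE (q : R) : 0 < q ->
  growth_rate q = pi / q ^+ 2 * tilted_mean A q + ln (2 * A + q).
Proof. by move=> q0; rewrite rate_tilted_mean. Qed.

(** After cross-multiplication the difference is [2 A (p^3 - q^3) + p q (p^2 - q^2)]. *)
Lemma tilted_mean_lt (q p : R) : 0 < q -> q < p ->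
  tilted_mean A q < tilted_mean A p.
Proof.
move=> q0 qp; have p0 := lt_trans q0 qp.
rewrite /tilted_mean !invfM !mulrA ltr_pdivlMr ?Z_gt0// mulrAC.
rewrite ltr_pdivrMr ?Z_gt0// -!mulrA mulrCA [ltRHS]mulrCA.
have := pi_gt0 R; rewrite -invr_gt0; move: (pi^-1 : R) => i i0.
suff H : q ^+ 3 * (2 * A + p) < p ^+ 3 * (2 * A + q).
  have := ltr_pM2l i0 (q ^+ 3 * (2 * A + p)) (p ^+ 3 * (2 * A + q)).
  by rewrite H; lra.
have q3p3 : q ^+ 3 < p ^+ 3 by rewrite ltrXn2r// ltW.
have q2p2 : q ^+ 2 < p ^+ 2 by rewrite ltrXn2r// ltW.
have := mulr_gt0 A0 (_ : 0 < p ^+ 3 - q ^+ 3); rewrite subr_gt0 => /(_ q3p3) H1.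
have := mulr_gt0 (mulr_gt0 q0 p0) (_ : 0 < p ^+ 2 - q ^+ 2).
by rewrite subr_gt0 => /(_ q2p2) H2; lra.
Qed.

Lemma tilted_mean_inj (q p : R) : 0 < q -> 0 < p ->
  tilted_mean A q = tilted_mean A p -> q = p.
Proof.
move=> q0 p0 E; have [qp|pq|//] := ltgtP q p.
- by have := tilted_mean_lt q0 qp; rewrite E ltxx.
- by have := tilted_mean_lt p0 pq; rewrite E ltxx.
Qed.

Lemma tilted_mean_surj (nu : R) : 0 < nu ->
  exists2 q, 0 < q & tilted_mean A q = nu.
Proof.
move=> nu0; have pi0 := pi_gt0 R.
have [k k0 kE] : exists2 k : R, 0 < k & k = 2 * pi * nu.
  by exists (2 * pi * nu) => //; rewrite !mulr_gt0.
pose g (q : R) := q ^+ 3 - k * (2 * A + q).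
(* Large enough that [M^3 >= M k (1 + 2 A) >= k (2 A + M)], so [g M] is nonnegative, while
   [g 0 = - 2 k A] is negative. *)
pose M := 1 + k * (1 + 2 * A).
have kA : 0 < k * A by rewrite mulr_gt0.
have M1 : 1 <= M by rewrite /M; lra.
have [q] : exists2 q, q \in `[0, M] & g q = 0.
  apply: IVT; first by apply: le_trans M1.
  - apply: continuous_subspaceT => x; apply: cvgB; first exact: exprn_continuous.
    by apply: cvgMr; apply: cvgD; [exact: cvg_cst|exact: cvg_id].
  - rewrite ge_min le_max; apply/andP; split; apply/orP; [left|right].
      by rewrite /g expr0n/=; lra.
    have M2 : M <= M ^+ 2 by rewrite expr2 ler_peMr// (le_trans ler01).
    rewrite /g exprS.
    have : M * (k * (1 + 2 * A)) <= M * M ^+ 2.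
      rewrite ler_wpM2l// ?(le_trans ler01)//; apply: le_trans M2.
      by rewrite /M; lra.
    by have := ler_wpM2r (ltW kA) M1; lra.
rewrite in_itv/= => /andP[q0 _] gq.
have {}q0 : 0 < q.
  rewrite lt_neqAle q0 andbT; apply/eqP => q0E; move: gq.
  by rewrite -q0E /g expr0n/=; lra.
exists q => //; have Z0 := Z_gt0 q0.
rewrite /tilted_mean; have -> : q ^+ 3 = k * (2 * A + q).
  by apply/eqP; rewrite -subr_eq0; apply/eqP.
rewrite kE; move: (pi : R) pi0 => p p0.
by field; rewrite !gt_eqF.
Qed.

Local Notation vol n nu := (fine (sublevel_volume A n nu)).

Lemma ln_sublevel_volume_le (n : nat) (nu q : R) : 0 < q ->
  (0 < n)%N -> 0 < vol n nu ->
  n%:R^-1 * ln (vol n nu) <= pi / q ^+ 2 * nu + ln (2 * A + q).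
Proof.
move=> q0 n0 v0; have := sublevel_volume_le A0 n nu q0.
rewrite (sublevel_volume_fin A0) lee_fin => H.
rewrite mulrC ler_pdivrMr ?ltr0n//.
rewrite -ler_ln ?posrE// in H; last first.
  by rewrite mulr_gt0 ?expR_gt0 ?exprn_gt0 ?Z_gt0.
apply: (le_trans H).
rewrite lnM ?posrE ?expR_gt0 ?exprn_gt0 ?Z_gt0//.
by rewrite expRK lnXn ?Z_gt0// -mulr_natl; lra.
Qed.

Lemma cvg_growth_rate (q : R) : 0 < q -> growth_rate p @[p --> q] --> growth_rate q.
Proof.
move=> q0; have Z0 := Z_gt0 q0.
have cZ : 2 * A + p @[p --> q] --> 2 * A + q.
  by apply: cvgD; [exact: cvg_cst|exact: cvg_id].
apply: cvgD.
  apply: cvgM; first exact: cvg_id.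
  apply: cvgV; first by rewrite mulf_neq0// gt_eqF.
  by apply: cvgMr.
apply: (@cvg_comp _ _ _ _ (@ln R) _ _ _ cZ).
exact: continuous_ln.
Qed.

(** The upper bound is Chernoff's at [q] itself. The lower bound tilts at some [p] slightly below
    [q], so that the tilted mean is strictly below the threshold, and uses continuity of
    [growth_rate]. *)
Lemma sublevel_volume_cvg (q : R) : 0 < q ->
  (\forall n \near \oo, 0 < vol n (tilted_mean A q)) /\
  n%:R^-1 * ln (vol n (tilted_mean A q)) @[n --> \oo] --> growth_rate q.
Proof.
move=> q0; set nu := tilted_mean A q.
have L (c : R) : c < growth_rate q -> \forall n \near \oo,
    0 < vol n nu /\ c <= n%:R^-1 * ln (vol n nu).
  move=> cq.
  have cv : growth_rate p @[p --> q^'-] --> growth_rate q.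
    by apply: cvg_at_left_filter; exact: cvg_growth_rate.
  near q^'- => p.
  have p0 : 0 < p by near: p; exact: nbhs_left_gt.
  have pq : p < q by [].
  have cp : c < growth_rate p by near: p; exact: cvgr_gt cv _ cq.
  have l0 : 0 < pi / p ^+ 2 :> R by rewrite divr_gt0 ?pi_gt0 ?exprn_gt0.
  move: cp; rewrite growth_rateE// => cp.
  (* The midpoint between the tilted mean at [p] and the value of [mu] at which the exponent would
     equal [c]. *)
  pose mu := ((c - ln (2 * A + p)) / (pi / p ^+ 2) + tilted_mean A p) / 2.
  have H : (c - ln (2 * A + p)) / (pi / p ^+ 2) < tilted_mean A p.
    by rewrite ltr_pdivrMr// [ltRHS]mulrC ltrBlDr.
  apply: (@sublevel_volume_growth _ _ A0 p mu) => //.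
  - by rewrite /mu; lra.
  - exact: tilted_mean_lt.
  - rewrite -ltrBlDr -ltr_pdivrMl// [ltLHS]mulrC /mu.
    by lra.
split; first by apply: filterS (L (growth_rate q - 1) _) => [n []//|]; lra.
apply/cvgrPdist_le => e e0.
have ce : growth_rate q - e < growth_rate q by rewrite ltrBlDr ltrDl.
near=> n.
have n0 : (0 < n)%N by near: n; exact: nbhs_infty_gt.
have [v0 cn] : 0 < vol n nu /\ growth_rate q - e <= n%:R^-1 * ln (vol n nu).
  by near: n; exact: L.
have := ln_sublevel_volume_le q0 n0 v0; rewrite -growth_rateE// => H.
by rewrite ger0_norm ?subr_ge0// lerBlDr -lerBlDl.
Unshelve. all: by end_near. Qed.

Local Lemma limn_esup_EFin (u : (\bar R)^nat) (w : R^nat) (l : R) :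
  (\forall n \near \oo, u n = (w n)%:E) -> w n @[n --> \oo] --> l ->
  limn_esup u = l%:E.
Proof.
move=> uw wl; have ul : u n @[n --> \oo] --> l%:E.
  apply/fine_cvgP; split; first by apply: filterS uw => n ->.
  apply: cvg_trans wl; apply: near_eq_cvg.
  by apply: filterS uw => n /= ->.
exact: (cvg_limn_einf_sup ul).2.
Qed.

Lemma ell_tilted_mean (q : R) : 0 < q ->
  ell A (tilted_mean A q) = (growth_rate q)%:E.
Proof.
move=> q0; have [v0 cv] := sublevel_volume_cvg q0.
apply: limn_esup_EFin cv.
apply: filterS v0 => n v0.
rewrite (Vol_minkowski_sum A0) ?(ltW (tilted_mean_gt0 q0))//.
rewrite -[lebesgue_tuple _]/(sublevel_volume A n (tilted_mean A q)).
by rewrite (sublevel_volume_fin A0) lne_EFin// -EFinM.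
Qed.

(** Optimality of [p = q] without calculus: each [p] bounds the same volumes from above, and their
    exponents converge to [growth_rate q]. *)
Lemma growth_rate_le (q p : R) : 0 < q -> 0 < p ->
  growth_rate q <= pi / p ^+ 2 * tilted_mean A q + ln (2 * A + p).
Proof.
move=> q0 p0; have [v0 cv] := sublevel_volume_cvg q0.
rewrite -(cvg_lim _ cv)//; apply: limr_le; first by apply/cvg_ex; eexists; exact: cv.
near=> n; apply: ln_sublevel_volume_le => //; first by near: n; exact: nbhs_infty_gt.
by near: n; exact: v0.
Unshelve. all: by end_near. Qed.

(** Treated apart because [tilted_mean] takes only positive values on positive [q]. At radius 0 the
    set is the cube, of volume [(2 A) ^+ n]. *)
Lemma ell0 : ell A 0 = (ln (2 * A))%:E.
Proof.
apply: (@limn_esup_EFin _ (fun=> ln (2 * A))); last exact: cvg_cst.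
near=> n.
(* At [n = 0] the prefactor [n^-1] is 0, so the sequence is constant only from [n = 1] on. *)
have n0 : (0 < n)%N by near: n; exact: nbhs_infty_gt.
rewrite (Vol_minkowski_sum A0)// mulr0.
rewrite (_ : [set t | _] =
    [set t : n.-tuple (measurableTypeR R) | forall i, `[- A, A]%classic (tnth t i)]).
  rewrite (@lebesgue_tuple_box R n (fun=> `[- A, A]%classic)); last by move=> i; exact: measurable_itv.
  under eq_bigr do rewrite lebesgue_measure_itv/= lte_fin gtrN// -EFinB opprK.
  have -> : A + A = 2 * A by ring.
  rewrite prodEFin big_const card_ord iter_mulr_1 lne_EFin ?exprn_gt0 ?mulr_gt0//.
  rewrite lnXn ?mulr_gt0// -EFinM -[ln _ *+ n]mulr_natl mulKf//.
  by rewrite pnatr_eq0 -lt0n.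
apply/seteqP; split=> t /=; rewrite /sqdist_tuple.
  move=> S0 i; rewrite in_itv/= -ler_norml.
  have : sqdist A (tnth t i) <= 0.
    apply: le_trans S0; rewrite (bigD1 i)//= lerDl sumr_ge0// => j _.
    exact: sqdist_ge0.
  rewrite le_eqVlt ltNge sqdist_ge0 orbF sqrf_eq0 => /eqP H.
  by rewrite -subr_le0 -H le_max lexx.
move=> H; rewrite big1// => i _; rewrite sqdist_in//.
by have := H i; rewrite in_itv/= -ler_norml.
Unshelve. all: by end_near. Qed.

Lemma growth_rate_ge (q : R) : 0 < q -> ln (2 * A) <= growth_rate q.
Proof.
move=> q0; have Z0 := Z_gt0 q0.
rewrite -[leLHS]add0r lerD//; first by rewrite divr_ge0 ?mulr_ge0// ltW.
by rewrite ler_ln ?posrE ?mulr_gt0// lerDl ltW.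
Qed.

Lemma fine_ell_tilted_mean (q : R) : 0 < q ->
  fine (ell A (tilted_mean A q)) = growth_rate q.
Proof. by move=> q0; rewrite ell_tilted_mean. Qed.

Lemma ell_within_continuous :
  {within `[0, +oo[, continuous (fun nu : R => fine (ell A nu))}.
Proof.
apply/continuous_within_itvcyP; split.
  move=> nu; rewrite in_itv/= andbT => nu0.
  have lam (q : R) : 0 < q -> pi / q ^+ 2 * tilted_mean A q <= 2^-1.
    move=> q0; rewrite rate_tilted_mean// invfM mulrCA ler_piMr//.
    by rewrite ler_pdivrMr ?Z_gt0// mul1r lerDr mulr_ge0// ltW.
  apply/cvgrPdist_le => e e0; near=> nu'.
  (* With [lam], this bounds the slope at [nu'] by [1 / (2 nu')], hence by [1 / nu]; the distance
     [e * nu] below is chosen accordingly. *)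
  have h : nu / 2 < nu'.
    by near: nu'; apply: lt_nbhsr; rewrite ltr_pdivrMr// ltr_pMr// ltr1n.
  have d : `|nu - nu'| <= e * nu.
    near: nu'; have /cvgrPdist_le := @cvg_id _ (nbhs nu); apply.
    by rewrite mulr_gt0.
  have nu'0 : 0 < nu' by apply: lt_trans h; rewrite divr_gt0.
  have [q q0 qE] := tilted_mean_surj nu0.
  have [q' q'0 q'E] := tilted_mean_surj nu'0.
  rewrite -qE -q'E !fine_ell_tilted_mean//.
  (* Testing each exponent against the other's optimal parameter bounds their difference on both
     sides by a slope times [nu - nu']. *)
  have I1 := growth_rate_le q0 q'0; have I2 := growth_rate_le q'0 q0.
  have J1 := lam _ q0; have J2 := lam _ q'0.
  have G1 := growth_rateE q0; have G2 := growth_rateE q'0.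
  rewrite qE q'E in I1 I2 J1 J2 G1 G2.
  have l0 : 0 <= pi / q ^+ 2 by rewrite divr_ge0 ?pi_ge0 ?sqr_ge0.
  have l0' : 0 <= pi / q' ^+ 2 by rewrite divr_ge0 ?pi_ge0 ?sqr_ge0.
  move: (pi / q ^+ 2) (pi / q' ^+ 2) l0 l0' I1 I2 J1 J2 G1 G2.
  move=> l l' l0 l0' I1 I2 J1 J2 G1 G2.
  have K (k : R) : 0 <= k -> k * nu <= 1 -> k * `|nu - nu'| <= e.
    move=> k0 kn; apply: (le_trans (ler_wpM2l k0 d)).
    by rewrite mulrCA ler_piMr// ltW.
  have K1 := K l l0; have K2 := K l' l0'.
  have N1 := ler_wpM2l l0' (ltW h).
  have {}K1 : l * `|nu - nu'| <= e by apply: K1; lra.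
  have {}K2 : l' * `|nu - nu'| <= e by apply: K2; lra.
  have A1 := ler_wpM2l l0 (ler_norm (nu' - nu)).
  have A2 := ler_wpM2l l0' (ler_norm (nu - nu')).
  rewrite distrC in A1.
  by rewrite ler_norml; apply/andP; split; lra.
rewrite ell0 /=.
(* The upper function is the Chernoff exponent at parameter [x^(1/4)]: its rate is [pi / sqrt x],
   and both this rate times [x] and the parameter itself vanish at 0. *)
apply: (@squeeze_cvgr _ _ _ _ (fun=> ln (2 * A)) (fun x : R =>
  pi * Num.sqrt x + ln (2 * A + Num.sqrt (Num.sqrt x)))).
- near=> x; have x0 : 0 < x by [].
  have s0 : 0 < Num.sqrt x by rewrite sqrtr_gt0.
  have [q q0 qE] := tilted_mean_surj x0.
  rewrite -qE fine_ell_tilted_mean// growth_rate_ge//= qE.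
  have p0 : 0 < Num.sqrt (Num.sqrt x) by rewrite sqrtr_gt0.
  have := growth_rate_le q0 p0; rewrite qE sqr_sqrtr ?(ltW s0)//.
  rewrite (_ : pi / Num.sqrt x * x = pi * Num.sqrt x)//.
  rewrite -{2}(sqr_sqrtr (ltW x0)) expr2 mulrA divfK ?gt_eqF//.
- exact: cvg_cst.
- apply: cvg_at_right_filter.
  have cs : continuous (@Num.sqrt R) by exact: sqrt_continuous.
  have c0 : Num.sqrt x @[x --> 0] --> (0 : R) by rewrite -[X in _ --> X]sqrtr0; exact: cs.
  have c2 : pi * Num.sqrt x @[x --> 0] --> (0 : R).
    by rewrite -[X in _ --> X](mulr0 pi); exact: cvgMr.
  rewrite -[X in _ --> X]add0r; apply: (cvgD c2).
  have c1 : 2 * A + Num.sqrt (Num.sqrt x) @[x --> 0] --> 2 * A.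
    rewrite -[X in _ --> X]addr0; apply: cvgD; first exact: cvg_cst.
    rewrite -[X in _ --> X]sqrtr0; exact: (cvg_comp _ _ c0 (cs 0)).
  apply: (@cvg_comp _ _ _ _ (@ln R) _ _ _ c1).
  by apply: continuous_ln; rewrite mulr_gt0.
Unshelve. all: by end_near. Qed.

Lemma theta_tilted_mean (q : R) : 0 < q -> let t := q / (2 * A + q) in
  0 < t < 1 /\ (1 - t) ^+ 2 / t ^+ 3 = 2 * A ^+ 2 / (pi * tilted_mean A q).
Proof.
move=> q0 t; have Z0 := Z_gt0 q0; split.
  by rewrite divr_gt0//= ltr_pdivrMr// mul1r ltrDr mulr_gt0.
have := pi_gt0 R; rewrite /t /tilted_mean; move: (pi : R) => p p0.
by field; rewrite !gt_eqF.
Qed.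

(** [q] inverts [t = q / (2 A + q)], so uniqueness of theta reduces to injectivity of
    [tilted_mean]. *)
Lemma theta_inv (t nu : R) : 0 < nu -> 0 < t < 1 ->
  (1 - t) ^+ 2 / t ^+ 3 = 2 * A ^+ 2 / (pi * nu) ->
  let q := 2 * A * t / (1 - t) in
  [/\ 0 < q, tilted_mean A q = nu & t = q / (2 * A + q)].
Proof.
move=> nu0 /andP[t0 t1] H q; have u0 : 0 < 1 - t by rewrite subr_gt0.
have q0 : 0 < q by rewrite divr_gt0// !mulr_gt0.
have ZE : 2 * A + q = 2 * A / (1 - t) by rewrite /q; field; rewrite gt_eqF.
split=> //; last by rewrite ZE /q; field; rewrite !gt_eqF.
move: H; have := pi_gt0 R; rewrite /tilted_mean ZE /q.
move: (pi : R) => p p0 H.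
(* The factor clears the denominators of [H], which then reads [p nu = 2 A^2 t^3 / (1 - t)^2]. *)
have : 2 * A ^+ 2 / (p * nu) * (p * nu * t ^+ 3 / (1 - t) ^+ 2) =
    2 * A ^+ 2 * t ^+ 3 / (1 - t) ^+ 2.
  by field; rewrite !gt_eqF.
rewrite -H.
rewrite (_ : (1 - t) ^+ 2 / t ^+ 3 * (p * nu * t ^+ 3 / (1 - t) ^+ 2) = p * nu);
  last by field; rewrite !gt_eqF.
move=> E; transitivity (2 * A ^+ 2 * t ^+ 3 / (1 - t) ^+ 2 / p).
  by field; rewrite !gt_eqF.
by rewrite -E; field; rewrite gt_eqF.
Qed.

(** The argument of the last logarithm collapses to [e q^2]. The terms in [ln q] and [ln (2 A)] then
    cancel against the entropy, leaving [t / 2 + ln (2 A + q)]. *)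
Lemma growth_rate_entropy (q : R) : 0 < q ->
  let t := q / (2 * A + q) in
  growth_rate q = binary_entropy t + (1 - t) * ln (2 * A)
    + t / 2 * ln (2 * pi * expR 1 * tilted_mean A q / t).
Proof.
move=> q0 t; have Z0 := Z_gt0 q0; have A20 : 0 < 2 * A by rewrite mulr_gt0.
have -> : 2 * pi * expR 1 * tilted_mean A q / t = expR 1 * q ^+ 2.
  have := pi_gt0 R; rewrite /t /tilted_mean; move: (pi : R) => p p0.
  by field; rewrite !gt_eqF.
rewrite [ln (expR _ * _)]lnM ?posrE ?expR_gt0 ?exprn_gt0// expRK lnXn// /binary_entropy.
have -> : 1 - t = 2 * A / (2 * A + q) by rewrite /t; field; rewrite gt_eqF.
rewrite /t !ln_div ?posrE// /growth_rate.
move: (ln q) (ln (2 * A)) (ln (2 * A + q)) => x y z.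
by rewrite -mulr_natl; field; rewrite gt_eqF.
Qed.

End exponent.

Theorem theorem7p1 (R : realType) (A : R) (hA : 0 < A) :
  [/\ forall nu : R, 0 <= nu -> ell A nu \is a fin_num,
      {within `[0, +oo[, continuous (fun nu : R => fine (ell A nu))} &
      forall nu : R, 0 < nu ->
        exists theta : R,
          unique (fun t : R =>
            0 < t < 1 /\ (1 - t) ^+ 2 / t ^+ 3 = 2 * A ^+ 2 / (pi * nu)) theta /\
          ell A nu =
            (binary_entropy theta + (1 - theta) * ln (2 * A)
              + theta / 2 * ln (2 * pi * expR 1 * nu / theta))%:E].
Proof.
split.
- move=> nu; rewrite le_eqVlt => /predU1P[<-|nu0]; first by rewrite ell0.
  have [q q0 <-] := tilted_mean_surj hA nu0.
  by rewrite ell_tilted_mean.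
- exact: ell_within_continuous.
move=> nu nu0; have [q q0 qE] := tilted_mean_surj hA nu0.
exists (q / (2 * A + q)); rewrite -qE; split; last first.
  by rewrite -growth_rate_entropy// ell_tilted_mean.
split; first exact: theta_tilted_mean.
rewrite qE => t [t01 tE].
have [p0 pE ->] := theta_inv hA nu0 t01 tE.
by congr (_ / (_ + _)); apply: (tilted_mean_inj hA) => //; rewrite pE.
Qed.
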